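(* Let $p$ be a prime and let $F$ be a finitely generated free group. Then the action of $F$ by left multiplication on its pro-$p$ completion (with normalized Haar measure) is weakly equivalent to the action of $F$ by left multiplication on its pro-(finite solvable) completion (with normalized Haar measure).
   Context: The pro-$p$ completion is the inverse limit of $F/N$ over normal subgroups $N$ of $p$-power index; the pro-(finite solvable) completion is the inverse limit of $F/N$ over normal subgroups $N$ with $F/N$ finite solvable. Weak containment: an action $f$ on $(X,\mu)$ weakly contains $g$ on $(Y,\nu)$ if for all measurable $A_1,\dots,A_n\subseteq Y$, finite $E\subseteq F$ and $\varepsilon>0$ there are measurable $B_1,\dots,B_n\subseteq X$ with $|\mu(B_i^\gamma\cap B_j)-\nu(A_i^\gamma\cap A_j)|<\varepsilon$ for all $i,j\le n$, $\gamma\in E$ (with $A^\gamma$ the image of $A$ under $\gamma$); weak equivalence means weak containment in both directions. *)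

(* Defs.v *)
From HB Require Import structures.
From mathcomp Require Import all_boot all_order all_algebra all_fingroup all_solvable.
From mathcomp Require Import all_classical all_reals all_analysis.
Set Implicit Arguments. Unset Strict Implicit. Unset Printing Implicit Defensive.
Import Order.TTheory GRing.Theory Num.Theory.
Local Open Scope classical_set_scope.

Section FreeGroup.
Variable n : nat.

(* a letter: generator index and exponent sign (true = inverse) *)
Definition letter := ('I_n * bool)%type.
Definition letinv (x : letter) : letter := (x.1, ~~ x.2).

Definition push (x : letter) (w : seq letter) : seq letter :=
  match w with
  | y :: w' => if y == letinv x then w' else x :: w
  | [::] => [:: x]
  end.

Definition reduce (s : seq letter) : seq letter := foldr push [::] s.

Definition reduced (w : seq letter) : bool :=
  sorted (fun x y => y != letinv x) w.

Lemma reduced_push x w : reduced w -> reduced (push x w).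
Proof.
case: w => [|y w] H; first by [].
rewrite /push; case: ifP => Hy.
  by move: H; rewrite /reduced; case: w => //= z w /andP[].
by move: H; rewrite /reduced /= Hy => ->.
Qed.

Lemma reduced_reduce s : reduced (reduce s).
Proof. by elim: s => [|x s IH] //=; exact: reduced_push. Qed.

Lemma reduce_id w : reduced w -> reduce w = w.
Proof.
elim: w => [|x w IH] //= H.
have Hw : reduced w by move: H; rewrite /reduced; case: w {IH} => //= y w /andP[].
rewrite IH //; case: w H {IH Hw} => [|y w] //= /andP[Hxy _].
by rewrite (negbTE Hxy).
Qed.

Definition FG := {w : seq letter | reduced w}.

Definition fgmul (a b : FG) : FG :=
  exist _ (reduce (sval a ++ sval b)) (reduced_reduce _).
Definition fgone : FG := exist _ [::] (erefl true).

Lemma fgmul1 (a : FG) : fgmul fgone a = a.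
Proof.
case: a => w Hw; rewrite /fgmul /=.
move: (reduced_reduce w); rewrite (reduce_id Hw) => H.
by rewrite (bool_irrelevance H Hw).
Qed.

(* N is the kernel of a surjective homomorphism from F_n onto a finite group
   gT satisfying the property Q; i.e. N is a normal subgroup with F_n/N
   isomorphic to such a finite group. *)
Definition quotient_kernel (Q : forall gT : finGroupType, Prop) (N : set FG) :=
  exists (gT : finGroupType) (phi : FG -> gT),
    [/\ forall a b, phi (fgmul a b) = (phi a * phi b)%g,
        forall g : gT, exists a, phi a = g,
        forall a, N a <-> phi a = 1%g
      & Q gT].

Definition pindex (p : nat) (N : set FG) :=
  quotient_kernel (fun gT => pgroup p (setTfor gT)) N.
Definition solvindex (N : set FG) :=
  quotient_kernel (fun gT => solvable (setTfor gT)) N.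

Section Completion.
Variable adm : set FG -> Prop.
Definition Idx := {N : set FG | adm N}.

(* an element of the inverse limit of F/N: a compatible family of cosets *)
Definition is_limpt (x : Idx -> set FG) : Prop :=
  (forall N : Idx, exists g : FG, x N = fgmul g @` (sval N)) /\
  (forall N M : Idx, sval N `<=` sval M -> x N `<=` x M).

Definition completion := {x : Idx -> set FG | is_limpt x}.

Lemma limpt_one : is_limpt (fun N => sval N).
Proof.
split; last by [].
move=> N; exists fgone; apply/seteqP; split => [h Nh|_ [h Nh <-]].
  by exists h => //; rewrite fgmul1.
by rewrite fgmul1.
Qed.

Definition cone : completion := exist _ _ limpt_one.

HB.instance Definition _ := gen_eqMixin completion.
HB.instance Definition _ := gen_choiceMixin completion.
HB.instance Definition _ := isPointed.Build completion cone.

(* cylinder sets {x | x_N = C} generate the (Borel) sigma-algebra *)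
Definition cylinders : set (set completion) :=
  [set A | exists (N : Idx) (C : set FG), A = [set x | sval x N = C]].

Definition Mcompletion := g_sigma_algebraType cylinders.

Definition setmul (A B : set FG) : set FG :=
  [set c | exists a b, [/\ A a, B b & c = fgmul a b]].

Definition ltrans (z : Mcompletion) (A : set Mcompletion) : set Mcompletion :=
  [set y | exists2 x, A x & forall N, sval y N = setmul (sval z N) (sval x N)].

Definition act_img (gamma : FG) (A : set Mcompletion) : set Mcompletion :=
  [set y | exists2 x, A x & forall N, sval y N = fgmul gamma @` (sval x N)].

Definition is_haar (R : realType) (mu : probability Mcompletion R) :=
  forall z A, measurable A -> mu (ltrans z A) = mu A.
End Completion.

Definition weakly_contains (R : realType) dX dY
    (X : measurableType dX) (Y : measurableType dY)
    (imgX : FG -> set X -> set X) (mu : probability X R)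
    (imgY : FG -> set Y -> set Y) (nu : probability Y R) :=
  forall (k : nat) (A : 'I_k -> set Y), (forall i, measurable (A i)) ->
  forall (E : seq FG) (eps : R), (0 < eps)%R ->
  exists B : 'I_k -> set X, (forall i, measurable (B i)) /\
    forall (i j : 'I_k) (gamma : FG), gamma \in E ->
      (`| fine (mu (imgX gamma (B i) `&` B j)) -
          fine (nu (imgY gamma (A i) `&` A j)) | < eps)%R.

Definition weakly_equivalent (R : realType) dX dY
    (X : measurableType dX) (Y : measurableType dY)
    (imgX : FG -> set X -> set X) (mu : probability X R)
    (imgY : FG -> set Y -> set Y) (nu : probability Y R) :=
  weakly_contains imgX mu imgY nu /\ weakly_contains imgY nu imgX mu.

End FreeGroup.

(* Main.v *)
Require Import Defs.
From HB Require Import structures.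
From mathcomp Require Import all_boot all_order all_algebra all_fingroup all_solvable.
From mathcomp Require Import all_classical all_reals all_analysis.
From mathcomp Require Import zify ring lra.
Set Implicit Arguments. Unset Strict Implicit. Unset Printing Implicit Defensive.
Import Order.TTheory GRing.Theory Num.Theory.

(** Finite p-groups are solvable, so the pro-solvable completion maps onto the
    pro-p one; the content is that the pro-p action weakly contains the other.
    Cylinder sets are dense in measure and Haar measure is uniform on every
    finite quotient, so it suffices to map, for each finite solvable quotient G
    of F, some finite p-quotient P of F to G in such a way that left
    multiplication by each generator is respected at all but a small proportion
    of the points of P; such a map is then automatically nearly equidistributed.

    First build a finite F-set Y with p-group monodromy and a map f : Y -> G
    that is almost equivariant, by descending along a chain of subgroups of G
    and asking for equivariance only up to right multiplication by H. To pass
    from H to K <| H with H/K cyclic generated by hK, write the error of f at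
    an edge as h^c modulo K with 0 <= c < |G|, let F act on Y x Z/p^k by adding
    c to the second coordinate, and put f'(y, m) = f(y) h^m for 0 <= m < p^k.
    The error now lies in K unless m + c wraps around, which is rare when
    p^k is large compared with |G|, even if |H/K| is prime to p. Finally the
    monodromy group P of Y is a p-group, and averaging over y shows that one of
    the orbit maps P -> Y -> G is almost equivariant. *)

(** * Free groups and their homomorphisms to finite groups *)

Section FreeGroupTheory.
Variable n : nat.
Implicit Types (x : letter n) (s w : seq (letter n)) (a b c : FG n).

Lemma letinvK : involutive (@letinv n).
Proof. by case=> i b; rewrite /letinv /= negbK. Qed.

Lemma FG_inj a b : sval a = sval b -> a = b.
Proof. by case: a b => [a ha] [b hb] /= ab; subst b; congr exist; exact: bool_irrelevance. Qed.

(** Reducedness matters when [w] begins with [x]: the inner push cancels that letter, and the outer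
    one restores it because the next letter cannot be [letinv x]. *)
Lemma push_letinvK x w : reduced w -> push x (push (letinv x) w) = w.
Proof.
case: w => [|y w] /= hw; first by rewrite eqxx.
rewrite letinvK; case: eqP hw => [->|_] hw /=; last by rewrite eqxx.
case: w hw => [//|z w] /= /andP[zx _].
by rewrite /push (negbTE zx).
Qed.

Lemma reduced_foldr_push s w : reduced w -> reduced (foldr (@push n) w s).
Proof. by move=> hw; elim: s => //= x s; exact: reduced_push. Qed.

(** A cancelling pair of letters acts trivially on reduced words, so reducing [s] does not change
    its action. Associativity of [fgmul] rests on this. *)
Lemma foldr_push_reduce w s :
  reduced w -> foldr (@push n) w (reduce s) = foldr (@push n) w s.
Proof.
move=> hw; elim: s => //= x s <-.
case: (reduce s) => //= y t; case: eqP => // ->.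
by rewrite push_letinvK// reduced_foldr_push.
Qed.

Lemma reduce_cat s t : reduce (s ++ t) = foldr (@push n) (reduce t) s.
Proof. by rewrite /reduce foldr_cat. Qed.

Lemma reduce_catl s t : reduce (reduce s ++ t) = reduce (s ++ t).
Proof. by rewrite !reduce_cat foldr_push_reduce// reduced_reduce. Qed.

Lemma reduce_catr s t : reduce (s ++ reduce t) = reduce (s ++ t).
Proof. by rewrite !reduce_cat (reduce_id (reduced_reduce t)). Qed.

Lemma fgmulA a b c : fgmul a (fgmul b c) = fgmul (fgmul a b) c.
Proof. by apply: FG_inj; rewrite /= reduce_catr reduce_catl catA. Qed.

Lemma fgmul_1r a : fgmul a (fgone n) = a.
Proof. by apply: FG_inj; rewrite /= cats0 reduce_id// (svalP a). Qed.

Definition fginv a : FG n :=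
  exist _ (reduce (rev (map (@letinv n) (sval a)))) (reduced_reduce _).

Lemma reduce_inv s : reduce (rev (map (@letinv n) s) ++ s) = [::].
Proof.
elim: s => //= x s ih; rewrite rev_cons cat_rcons -reduce_catr.
suff -> : reduce [:: letinv x, x & s] = reduce s by rewrite reduce_catr.
by rewrite /= -{2}(letinvK x) push_letinvK// reduced_reduce.
Qed.

Lemma fgmulVg a : fgmul (fginv a) a = fgone n.
Proof. by apply: FG_inj; rewrite /= reduce_catl reduce_inv. Qed.

Lemma fginvK a : fginv (fginv a) = a.
Proof.
rewrite -[LHS]fgmul_1r -(fgmulVg a) fgmulA fgmulVg.
exact: fgmul1.
Qed.

Lemma fgmulgV a : fgmul a (fginv a) = fgone n.
Proof. by rewrite -{1}(fginvK a) fgmulVg. Qed.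

Lemma fgmulKV a b : fgmul a (fgmul (fginv a) b) = b.
Proof. by rewrite fgmulA fgmulgV fgmul1. Qed.

Lemma fgmulVK a b : fgmul (fginv a) (fgmul a b) = b.
Proof. by rewrite fgmulA fgmulVg fgmul1. Qed.

Definition gen (i : 'I_n) : FG n := exist _ [:: (i, false)] (erefl true).

Section Homs.
Variable gT : finGroupType.
Local Open Scope group_scope.

Definition fghom (phi : FG n -> gT) := forall a b, phi (fgmul a b) = phi a * phi b.

Definition eval_letter (t : 'I_n -> gT) x : gT := if x.2 then (t x.1)^-1 else t x.1.

Definition eval_word (t : 'I_n -> gT) w : gT :=
  foldr (fun x g => eval_letter t x * g) 1 w.

Lemma eval_letter_inv t x : eval_letter t (letinv x) = (eval_letter t x)^-1.
Proof. by rewrite /eval_letter; case: x => i [] //=; rewrite invgK. Qed.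

Lemma eval_word_cat t s w : eval_word t (s ++ w) = eval_word t s * eval_word t w.
Proof. by elim: s => [|x s /= ->]; rewrite ?mul1g ?mulgA. Qed.

Lemma eval_word_reduce t s : eval_word t (reduce s) = eval_word t s.
Proof.
elim: s => //= x s <-; case: (reduce s) => //= y w.
by case: eqP => //= ->; rewrite eval_letter_inv mulKVg.
Qed.

(** Existence in the universal property of the free group; [fghomE] gives uniqueness. *)
Lemma fghom_eval t : fghom (fun a => eval_word t (sval a)).
Proof. by move=> a b; rewrite /= eval_word_reduce eval_word_cat. Qed.

Lemma fghom1 phi : fghom phi -> phi (fgone n) = 1.
Proof. by move=> h; apply: (mulgI (phi (fgone n))); rewrite -h fgmul1 mulg1. Qed.

Lemma fghomV phi a : fghom phi -> phi (fginv a) = (phi a)^-1.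
Proof. by move=> h; apply: (mulgI (phi a)); rewrite -h fgmulgV mulgV fghom1. Qed.

Lemma fghomE phi a : fghom phi -> phi a = eval_word (phi \o gen) (sval a).
Proof.
move=> h; case: a => w hw; elim: w hw => [|x w ih] hw /=.
  by rewrite -(fghom1 h); congr phi; exact: FG_inj.
have hw' : reduced w by case: w hw {ih} => //= y w /andP[].
rewrite -(ih hw').
have -> : eval_letter (phi \o gen) x = phi (exist _ [:: x] (erefl true)).
  case: x hw => i [] hw; rewrite /eval_letter /=; last by congr phi; exact: FG_inj.
  by rewrite -fghomV//; congr phi; apply: FG_inj.
rewrite -h; congr phi; apply: FG_inj.
exact: esym (reduce_id hw).
Qed.

End Homs.

Section Corestriction.
Variables (gT : finGroupType) (phi : FG n -> gT) (hphi : fghom phi).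
Local Open Scope group_scope.

Definition image_set : {set gT} := [set g | `[< exists a, phi a = g >]].

Fact image_group_set : group_set image_set.
Proof.
apply/group_setP; split => [|x y].
  by rewrite finset.in_set; apply/asboolP; exists (fgone n); rewrite fghom1.
rewrite !finset.in_set => /asboolP[a <-] /asboolP[b <-]; apply/asboolP.
by exists (fgmul a b); rewrite hphi.
Qed.
Definition image_group : {group gT} := Group image_group_set.

Definition corestr a : subg_of image_group := subg image_group (phi a).

Lemma corestrE a : sgval (corestr a) = phi a.
Proof. by rewrite subgK// finset.in_set; apply/asboolP; exists a. Qed.

Lemma corestr_hom : fghom corestr.
Proof. by move=> a b; apply: val_inj; rewrite /= !corestrE hphi. Qed.

Lemma corestr_surj g : exists a, corestr a = g.
Proof.
have := subgP g; rewrite finset.in_set => /asboolP[a ag].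
by exists a; apply: val_inj; rewrite /= corestrE.
Qed.

End Corestriction.
End FreeGroupTheory.

(** * Almost equivariant maps from p-group actions *)

Section SkewProduct.
Variables (Y : finType) (M : nat).
Local Open Scope group_scope.
Implicit Types (s t : {perm Y}) (c d : Y -> 'I_M.+1).

Definition skew_fun s c (z : Y * 'I_M.+1) := (s z.1, (z.2 + c z.1)%R).

Fact skew_fun_inj s c : injective (skew_fun s c).
Proof.
case=> [y m] [y' m'] e; have /perm_inj/= yy' := congr1 fst e.
by have /= := congr1 snd e; rewrite -yy' => /addIr ->.
Qed.

Definition skew s c : {perm Y * 'I_M.+1} := perm (@skew_fun_inj s c).

Lemma skewM s t c d :
  skew s c * skew t d = skew (s * t) (fun y => c y + d (s y))%R.
Proof.
by apply/permP => -[y m]; rewrite permM !permE /skew_fun /= permM addrA.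
Qed.

Lemma skew1X c k : skew 1 c ^+ k = skew 1 (fun y => c y *+ k)%R.
Proof.
elim: k => [|k ih].
  by apply/permP => -[y m]; rewrite expg0 perm1 permE /skew_fun /= perm1 mulr0n addr0.
rewrite expgSr ih skewM mulg1; congr skew.
by apply/funext => y; rewrite perm1 mulrSr.
Qed.

Lemma skewX s c k : exists d, skew s c ^+ k = skew (s ^+ k) d.
Proof.
elim: k => [|k [d ih]].
  exists (fun=> 0%R); apply/permP => -[y m].
  by rewrite !expg0 perm1 permE /skew_fun /= perm1 addr0.
by exists (fun y => d y + c ((s ^+ k)%g y))%R; rewrite expgSr ih skewM -expgSr.
Qed.

(** The permutational wreath product of Z/(M+1) by [G]. Allowing every [c] makes it closed under the
    product computed in [skewM]. *)
Definition skew_set (G : {group {perm Y}}) : {set {perm Y * 'I_M.+1}} :=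
  [set w | `[< exists2 s, s \in G & exists c, w = skew s c >]].

Fact skew_group_set G : group_set (skew_set G).
Proof.
apply/group_setP; split => [|u v]; rewrite !finset.in_set.
  apply/asboolP; exists 1; rewrite ?group1//; exists (fun=> 0%R).
  by apply/permP => -[y m]; rewrite perm1 permE /skew_fun /= perm1 addr0.
move=> /asboolP[s sG [c ->]] /asboolP[t tG [d ->]]; apply/asboolP.
exists (s * t); first by rewrite groupM.
by eexists; rewrite skewM.
Qed.
Definition skew_group G := Group (skew_group_set G).

(** The power [#|G|] kills the permutation part and the further power [M.+1] kills the translation
    part. Hence the order of each element is a [p]-number, and Cauchy's theorem concludes. *)
Lemma skew_pgroup p (G : {group {perm Y}}) :
  p.-group G -> p.-nat M.+1 -> p.-group (skew_group G).
Proof.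
move=> pG pM; apply/pgroupP => q qp /(Cauchy qp)[w].
rewrite finset.in_set => /asboolP[s sG [c ->]] oq.
have : skew s c ^+ (#|G| * M.+1) = 1.
  rewrite expgM; have [d ->] := skewX s c #|G|.
  rewrite expg_cardG// skew1X; apply/permP => -[y m].
  rewrite perm1 permE /skew_fun /= perm1; congr pair.
  suff -> : (d y *+ M.+1 = 0)%R by rewrite addr0.
  by apply: val_inj; rewrite Zp_mulrn /= modnMl.
move/eqP; rewrite -order_dvdn oq => qd.
have : p.-nat (#|G| * M.+1)%N by rewrite pnatM pM andbT.
by move/(pnat_dvd qd); rewrite pnatE.
Qed.

End SkewProduct.

(** * Descent along subgroups of a finite solvable group *)

Section Approximation.
Variables (n p : nat) (gT : finGroupType) (g : 'I_n -> gT).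
Hypothesis p_prime : prime p.
Local Open Scope group_scope.

(* [tau i] is the action of the i-th generator on Y. *)
Definition p_approximable (H : {group gT}) :=
  forall N : nat, exists (Y : finType) (tau : 'I_n -> {perm Y}) (f : Y -> gT),
    [/\ (0 < #|Y|)%N, p.-group <<[set tau i | i : 'I_n]>> &
      (#|[set z : Y * 'I_n | ((f (tau z.2 z.1))^-1 * (g z.2 * f z.1))%g \notin H]| * N
        <= #|Y|)%N].

Lemma p_approximable_setT : p_approximable [set: gT]%G.
Proof.
move=> N; exists unit, (fun=> 1), (fun=> 1); split.
- by rewrite card_unit.
- apply: (pgroupS (G := 1%G)); last exact: pgroup1.
  by rewrite gen_subG; apply/fintype.subsetP => _ /imsetP[i _ ->]; rewrite finset.inE.
- by rewrite eq_card0// => z; rewrite !finset.inE.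
Qed.

Lemma p_approximable_normal (H K : {group gT}) :
  normal K H -> cyclic (H / K) -> p_approximable H -> p_approximable K.
Proof.
move=> /andP[KH nKH] /cyclicP[hbar HKE] aH N.
have : hbar \in H / K by rewrite HKE cycle_id.
rewrite -imset_coset => /imsetP[h hH hh].
have hN : h \in 'N(K) := fintype.subsetP nKH _ hH.
have powh u : u \in H -> exists2 c, (c < #|gT|)%N & h ^- c * u \in K.
  move=> uH; have uN := fintype.subsetP nKH _ uH.
  have /cycleP[m um] : coset K u \in <[hbar]>.
    by rewrite -HKE; exact: mem_quotient.
  exists (m %% #[h]).
    by rewrite (leq_trans (ltn_pmod _ (order_gt0 h)))// max_card.
  rewrite expg_mod_order; apply: coset_idr; first by rewrite groupM ?groupV ?groupX.
  by rewrite morphM ?groupV ?groupX// morphV ?groupX// morphX//= um hh mulVg.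
pose q := #|gT|.
(* Half of the allowance is left to the bad edges of [f], whence [2 * N] below. The other half
   covers wraparound, since [k < p ^ k]. *)
pose k := (2 * N * n * q)%N.
have [Y [tau [f [Y0 ptau bad]]]] := aH (2 * N)%N.
pose M := (p ^ k).-1.
have ME : M.+1 = (p ^ k)%N by rewrite prednK// expn_gt0 prime_gt0.
have pickc i y : {c | (c < q)%N /\ ((f (tau i y))^-1 * (g i * f y) \in H ->
    h ^- c * ((f (tau i y))^-1 * (g i * f y)) \in K)}.
  apply: cid; have [uH|//] := boolP (_ \in H).
    by have [c ? ?] := powh _ uH; exists c.
  (* On an edge that is already bad for [f] the shift is arbitrary. *)
  by exists 0%N; split=> //; apply/card_gt0P; exists 1.
pose c i y := sval (pickc i y).
have cq i y : (c i y < q)%N := (svalP (pickc i y)).1.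
have cK i y := (svalP (pickc i y)).2.
pose tau' i := skew (tau i) (fun y => inZp (c i y) : 'I_M.+1).
pose f' (z : Y * 'I_M.+1) := f z.1 * h ^+ z.2.
exists _, tau', f'; split.
- by rewrite card_prod card_ord muln_gt0 Y0.
- apply: pgroupS (skew_pgroup ptau _); last by rewrite ME pnatX pnat_id.
  rewrite gen_subG; apply/fintype.subsetP => _ /imsetP[i _ ->].
  rewrite finset.in_set; apply/asboolP; exists (tau i); last by eexists.
  by apply: mem_gen; apply: imset_f.
set B' := finset _; set B := finset _ in bad.
(* A bad edge for [f'] lies over a bad edge for [f], or starts among the top [q] levels, where
   adding [c i y < q] may wrap around. *)
pose C1 := [set z : (Y * 'I_M.+1) * 'I_n | (z.1.1, z.2) \in B].
pose C2 := [set z : (Y * 'I_M.+1) * 'I_n | (M.+1 <= z.1.2 + q)%N].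
have BC : B' \subset C1 :|: C2.
  apply/fintype.subsetP => -[[y m] i]; rewrite /C1 /C2 /B !finset.inE /= permE /skew_fun /=.
  apply: contraR; rewrite negb_or -ltnNge negbK => /andP[uH mq].
  rewrite /f' /=.
  have cM : (m + c i y < M.+1)%N by have := cq i y; move: mq; rewrite -/q; lia.
  have ci : (c i y < M.+1)%N := leq_ltn_trans (leq_addl _ _) cM.
  rewrite (modn_small ci) (modn_small cM) addnC expgD.
  (* Without wraparound, the new error is a conjugate of the corrected old one by a power of [h],
     which normalizes [K]. *)
  suff -> : (f (tau i y) * (h ^+ c i y * h ^+ m))^-1 * (g i * (f y * h ^+ m)) =
      (h ^- c i y * ((f (tau i y))^-1 * (g i * f y))) ^ (h ^+ m).
    by rewrite memJ_norm ?groupX// cK.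
  by rewrite conjgE !invMg !mulgA.
have C1le : (#|C1| <= #|B| * M.+1)%N.
  have -> : (#|B| * M.+1 = #|finset.setX B [set: 'I_M.+1]|)%N.
    by rewrite cardsX cardsT card_ord.
  apply: leq_trans (leq_imset_card (fun z => ((z.1.1, z.2), z.1.2)) _).
  apply/subset_leq_card/fintype.subsetP => -[[y m] i]; rewrite finset.in_set /= => yiB.
  by apply/imsetP; exists (y, i, m); rewrite // finset.in_setX yiB finset.in_setT.
have C2le : (#|C2| <= #|Y| * n * q)%N.
  have -> : (#|Y| * n * q = #|[set: Y * 'I_n * 'I_q]|)%N.
    by rewrite cardsT !card_prod !card_ord.
  pose F (z : Y * 'I_n * 'I_q) := ((z.1.1, inord (M - z.2) : 'I_M.+1), z.1.2).
  apply: leq_trans (leq_imset_card F _).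
  apply/subset_leq_card/fintype.subsetP => -[[y m] i]; rewrite finset.in_set /= => mq.
  have rq : (M - m < q)%N by have := ltn_ord m; lia.
  apply/imsetP; exists (y, i, Ordinal rq); rewrite ?finset.in_setT // /F /=.
  congr (_, _, _); apply: val_inj; rewrite /= inordK; have := ltn_ord m; rewrite -/M; lia.
have := subset_leq_card BC; rewrite cardsU => /leq_trans/(_ (leq_subr _ _)) B'le.
rewrite card_prod card_ord.
apply: (@leq_trans ((#|B| * M.+1 + #|Y| * n * q) * N)).
  by rewrite leq_mul2r (leq_trans B'le) ?orbT// leq_add.
have : (k < M.+1)%N by rewrite ME ltn_expl// prime_gt1.
rewrite /k; move: bad Y0; clear; move: #|B| #|Y| => b y *.
nia.
Qed.

(** A nontrivial solvable group has a normal subgroup of prime index, so the descent step reaches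
    the trivial group by induction on the order. *)
Lemma p_approximable1 : solvable [set: gT] -> p_approximable 1%G.
Proof.
suff ind m (H : {group gT}) : (#|H| <= m)%N -> solvable H -> p_approximable H ->
    p_approximable 1%G.
  by move=> solG; apply: (ind _ [set: gT]%G (leqnn _) solG) p_approximable_setT.
elim: m H => [|m ih] H; first by rewrite leqNgt cardG_gt0.
have [-> //|H1 Hm solH aH] := eqVneq H 1%G.
have [K KH prKH] := sol_prime_factor_exists solH H1.
apply: (ih K).
- rewrite -ltnS (leq_trans _ Hm)//; apply: proper_card.
  rewrite finset.properEneq normal_sub// andbT; apply: contraTneq prKH => ->.
  by rewrite indexgg.
- by apply: solvableS solH; exact: normal_sub.
- apply: p_approximable_normal aH => //; apply: prime_cyclic.
  by rewrite card_quotient// normal_norm.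
Qed.

End Approximation.

(** * Propagation of equivariance errors from generators to words *)

Section Defect.
Variables (uT vT : finGroupType) (f : uT -> vT).
Local Open Scope group_scope.

Definition defect u v := #|[set t | f (u * t) != v * f t]|.

Lemma defect1 : defect 1 1 = 0%N.
Proof. by rewrite /defect eq_card0// => t; rewrite finset.in_set !mul1g eqxx. Qed.

(** An error for the product at [t] comes from an error for [u'] at [t] or for [u] at [u' * t];
    translation by [u'] preserves the number of the latter. *)
Lemma defectM u v u' v' : (defect (u * u') (v * v') <= defect u v + defect u' v')%N.
Proof.
have -> : defect u v = #|[set t | f (u * (u' * t)) != v * f (u' * t)]|.
  rewrite -[RHS](card_imset _ (mulgI u')); apply: eq_card => t.
  by rewrite -[t](mulKVg u') mem_imset ?finset.in_set//; exact: mulgI.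
rewrite /defect -cardsUI (leq_trans _ (leq_addr _ _))//; apply/subset_leq_card.
apply/fintype.subsetP => t; rewrite !finset.inE; apply: contraR.
rewrite negb_or !negbK => /andP[/eqP + /eqP e].
by rewrite e !mulgA => ->.
Qed.

Lemma defectV u v : (defect u^-1 v^-1 <= defect u v)%N.
Proof.
rewrite {1}/defect -(card_imset _ (mulgI u^-1)); apply/subset_leq_card.
apply/fintype.subsetP => _ /imsetP[t + ->]; rewrite !finset.in_set mulKVg.
by apply: contraNneq => ->; rewrite mulKg.
Qed.

Variable n : nat.

Lemma defect_word (u : 'I_n -> uT) (v : 'I_n -> vT) w :
  (defect (eval_word u w) (eval_word v w) <=
    size w * \sum_i defect (u i) (v i))%N.
Proof.
elim: w => [|x w ih] /=; first by rewrite defect1.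
apply: leq_trans (defectM _ _ _ _) _; rewrite mulSn leq_add//.
rewrite (bigD1 x.1)//= (leq_trans _ (leq_addr _ _))//.
by rewrite /eval_letter; case: x.2; rewrite // defectV.
Qed.
End Defect.

(** * Passage from a finite action to its monodromy group *)

Section PGroupApproximation.
Variables (n p : nat) (gT : finGroupType) (phi : FG n -> gT).
Hypotheses (p_prime : prime p) (hphi : fghom phi) (solG : solvable [set: gT]).
Local Open Scope group_scope.

Lemma p_group_approximation (L : seq (FG n)) (K : nat) :
  exists (pT : finGroupType) (psi : FG n -> pT) (f : pT -> gT),
    [/\ fghom psi, forall t, exists a, psi a = t, p.-group [set: pT] &
      forall a, a \in L -> (defect f (psi a) (phi a) * K <= #|pT|)%N].
Proof.
(* By [defect_word], an element costs at most its word length times the total generator defect; this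
   [N] dominates that cost for all of [L]. *)
pose N := (\sum_(a <- L) size (sval a) * K)%N.
have [Y [tau [f [Y0 ptau bad]]]] := p_approximable1 (phi \o @gen n) p_prime solG N.
(* Permutations multiply from left to right. Inverting the generators here and [t] in [F] makes left
   multiplication by a generator move the point [t^-1 y] by [tau i]. *)
pose theta (a : FG n) := eval_word (fun i => (tau i)^-1) (sval a).
have htheta : fghom theta by exact: fghom_eval.
pose P := image_group htheta.
pose psi := corestr htheta.
pose F y (t : subg_of P) := f ((sgval t)^-1 y).
have [y yN] : exists y, ((\sum_i defect (F y) (psi (gen i)) (phi (gen i))) * N <=
    #|subg_of P|)%N.
  set Bad := finset _ in bad.
  have defE y i : defect (F y) (psi (gen i)) (phi (gen i)) =
      (\sum_(t : subg_of P) (((sgval t)^-1 y, i) \in Bad))%N.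
    rewrite /defect -sum1_card big_mkcond/=; apply: eq_bigr => t _.
    rewrite !finset.in_set /F /= corestrE /theta /= mulg1 /eval_letter /= invMg invgK permM.
    by rewrite finset.in_set1 -eq_mulVg1; case: eqP.
  (* For fixed [t], the point [t^-1 y] runs once through [Y] as [y] does, so each [t] meets every
     bad edge exactly once. *)
  have sumE : (\sum_y \sum_i defect (F y) (psi (gen i)) (phi (gen i)) =
      #|subg_of P| * #|Bad|)%N.
    under eq_bigr => y _ do under eq_bigr => i _ do rewrite defE.
    under eq_bigr => y _ do rewrite exchange_big.
    rewrite exchange_big /= -sum_nat_const; apply: eq_bigr => t _.
    rewrite [RHS](_ : _ = \sum_y \sum_i ((y, i) \in Bad))%N; last first.
      by rewrite pair_big/= -sum1_card big_mkcond/=; apply: eq_bigr => -[].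
    rewrite [RHS](reindex_inj (@perm_inj _ (sgval t)^-1)).
    by [].
  (* If every [y] failed, summing over [Y] would contradict [bad]; a point [y0] is split off to keep
     the inequality strict. *)
  apply/existsP; apply: contraLR bad; rewrite negb_exists => /forallP yN.
  rewrite -ltnNge -(ltn_pmul2l (m := #|subg_of P|)); last by apply/card_gt0P; exists 1.
  rewrite mulnA -sumE big_distrl /= mulnC -sum_nat_const.
  have [y0 _] := card_gt0P Y0.
  rewrite (bigD1 y0)//= [ltnRHS](bigD1 y0)//= -addSn leq_add//.
    by rewrite ltnNge.
  by apply: leq_sum => y _; rewrite ltnW// ltnNge.
exists (subg_of P), psi, (F y); split.
- exact: corestr_hom.
- exact: corestr_surj.
- rewrite /pgroup -(card_isog (isog_subg P)).
  apply: pgroupS ptau; apply/fintype.subsetP => s.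
  rewrite finset.in_set => /asboolP[a <-]; rewrite /theta; elim: (sval a) => [|x w ih] /=.
    exact: group1.
  rewrite groupM// /eval_letter.
  by case: x.2; rewrite ?invgK ?groupV mem_gen// imset_f.
- move=> a aL; apply: leq_trans yN.
  have hpsi : fghom psi by exact: corestr_hom.
  rewrite (fghomE a hpsi) (fghomE a hphi).
  apply: (@leq_trans (size (sval a) * (\sum_i defect (F y) (psi (gen i)) (phi (gen i))) * K)).
    by rewrite leq_mul2r defect_word orbT.
  rewrite mulnAC mulnC leq_mul2l; apply/orP; right.
  by rewrite /N (big_rem a aL)/= leq_addr.
Qed.

End PGroupApproximation.

(** * Profinite completions and their cylinder sets *)

Lemma sval_inj (T : Type) (P : T -> Prop) : injective (@sval T P).
Proof. by case=> [x Px] [y Py] /= xy; exact: eq_exist. Qed.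

Section Completions.
Variables (n : nat) (Q : forall gT : finGroupType, Prop).
Local Open Scope classical_set_scope.

(** Keeps as data the map that [quotient_kernel] only asserts to exist, so that cosets are named by
    elements of a finite group. *)
Record fquot := FQuot {
  fq_type : finGroupType;
  fq_map :> FG n -> fq_type;
  fq_hom : fghom fq_map;
  fq_surj : forall g, exists a, fq_map a = g;
  fq_prop : Q fq_type }.

Local Notation adm := (@quotient_kernel n Q).
Local Notation T := (Mcompletion adm).
Implicit Types (D : fquot) (x y : T) (gamma : FG n).

Fact fq_ker_adm D : adm [set a | D a = 1%g].
Proof. by exists (fq_type D), D; split; [exact: fq_hom|exact: fq_surj| |exact: fq_prop]. Qed.

Definition fq_idx D : Idx adm := exist _ _ (fq_ker_adm D).

Lemma Idx_fq (N : Idx adm) : exists D, N = fq_idx D.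
Proof.
case: N => N admN; have [gT [phi [h s k q]]] := admN.
by exists (FQuot h s q); apply: sval_inj; apply/seteqP; split => a /=; rewrite k.
Qed.

Lemma completion_ext x y : (forall N, sval x N = sval y N) -> x = y.
Proof. by move=> xy; apply: sval_inj; apply/funext. Qed.

Lemma coset_fq D gamma :
  fgmul gamma @` sval (fq_idx D) = [set a | D a = D gamma].
Proof.
apply/seteqP; split => [_ [a /= Da <-]|a /= Da]; first by rewrite fq_hom Da mulg1.
exists (fgmul (fginv gamma) a); last exact: fgmulKV.
by rewrite /= fq_hom fghomV; [rewrite Da mulVg|exact: fq_hom].
Qed.

(** The projection of the completion to a finite quotient. The representative is chosen, but its
    image under [D] depends only on the coset. *)
Definition fq_proj D x : fq_type D := D (sval (cid ((svalP x).1 (fq_idx D)))).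

Lemma fq_projE D x : sval x (fq_idx D) = [set a | D a = fq_proj D x].
Proof. by rewrite /fq_proj; case: cid => g /= ->; exact: coset_fq. Qed.

Lemma fq_proj_unique D x g : sval x (fq_idx D) = [set a | D a = g] -> fq_proj D x = g.
Proof.
have [a Da] := fq_surj (fq_proj D x); rewrite fq_projE => e.
by rewrite -Da; have : [set a | D a = g] a by rewrite -e.
Qed.

Lemma fq_proj_le D D' (u : fq_type D -> fq_type D') x :
  (forall a, D' a = u (D a)) -> fq_proj D' x = u (fq_proj D x).
Proof.
move=> DD'; have [a Da] := fq_surj (fq_proj D x).
have kerDD' : sval (fq_idx D) `<=` sval (fq_idx D').
  move=> b /= Db; rewrite DD' Db -(fghom1 (@fq_hom D)) -DD' fghom1//.
  exact: fq_hom.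
have /(_ a) := (svalP x).2 _ _ kerDD'; rewrite !fq_projE /= => /(_ Da) <-.
by rewrite DD' Da.
Qed.

Fact fgmul_limpt gamma x : is_limpt (fun N => fgmul gamma @` sval x N).
Proof.
split=> [N|N M NM]; last by apply: image_subset; exact: (svalP x).2.
have [g ->] := (svalP x).1 N; exists (fgmul gamma g).
by rewrite image_comp; apply: eq_imagel => a _ /=; rewrite fgmulA.
Qed.

Definition trans gamma x : T := exist _ _ (fgmul_limpt gamma x).

Lemma transK gamma : cancel (trans gamma) (trans (fginv gamma)).
Proof.
move=> x; apply: completion_ext => N /=; rewrite image_comp -[RHS]image_id.
by apply: eq_imagel => a _ /=; rewrite fgmulVK.
Qed.

(** Translation is a bijection; as a preimage under its inverse, the image commutes with set
    operations and is easily seen to be measurable. *)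
Lemma act_imgE gamma (A : set T) : act_img gamma A = trans (fginv gamma) @^-1` A.
Proof.
apply/seteqP; split => [y [x Ax yx]|y Ay] /=.
  by rewrite (_ : y = trans gamma x) ?transK//; exact: completion_ext.
exists (trans (fginv gamma) y) => // N; rewrite -{1}(transK (fginv gamma) y).
by rewrite fginvK.
Qed.

Lemma fq_proj_trans D gamma x : fq_proj D (trans gamma x) = (D gamma * fq_proj D x)%g.
Proof.
apply: fq_proj_unique; rewrite /= fq_projE; apply/seteqP; split.
  by move=> _ [a /= <- <-]; rewrite fq_hom.
move=> a /= Da; exists (fgmul (fginv gamma) a); last exact: fgmulKV.
by rewrite /= fq_hom fghomV ?Da ?mulKg//; exact: fq_hom.
Qed.

Lemma measurable_trans gamma (A : set T) :
  measurable A -> measurable (trans gamma @^-1` A).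
Proof.
apply: (smallest_sub (X := [set A : set T | measurable (trans gamma @^-1` A)])).
  split; first by rewrite /= preimage_set0.
    by move=> B /= mB; rewrite setTD preimage_setC; exact: measurableC.
  by move=> F mF; rewrite /= preimage_bigcup; exact: bigcupT_measurable.
move=> _ [N [C ->]] /=; apply: sub_sigma_algebra.
exists N, (fgmul (fginv gamma) @` C); apply/seteqP; split => x /=.
  by move=> <-; have /= := congr1 (fun y : T => sval y N) (transK gamma x).
by move=> ->; rewrite image_comp -[RHS]image_id; apply: eq_imagel => a _ /=; rewrite fgmulKV.
Qed.

Lemma measurable_act_img gamma (A : set T) : measurable A -> measurable (act_img gamma A).
Proof. by rewrite act_imgE; exact: measurable_trans. Qed.

Definition cyl D (S : {set fq_type D}) : set T := fq_proj D @^-1` [set` S].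

Lemma act_img_cyl gamma D (S : {set fq_type D}) :
  act_img gamma (cyl S) = cyl [set g | ((D gamma)^-1 * g)%g \in S]%SET.
Proof.
rewrite act_imgE /cyl; apply/seteqP; split => x /=;
by rewrite fq_proj_trans finset.in_set fghomV//; exact: fq_hom.
Qed.

Lemma measurable_cyl D (S : {set fq_type D}) : measurable (cyl S).
Proof.
rewrite (_ : cyl S = \bigcup_(g in [set` S]) [set x : T | sval x (fq_idx D) = [set a | D a = g]]).
  apply: fin_bigcup_measurable => // g _; apply: sub_sigma_algebra.
  by exists (fq_idx D), [set a | D a = g].
apply/seteqP; split => x /=.
  by move=> Sx; exists (fq_proj D x) => //; exact: fq_projE.
by case=> g Sg /fq_proj_unique; rewrite /cyl /= => ->.
Qed.

Lemma cylinders_cyl (A : set T) : cylinders A -> exists D (S : {set fq_type D}), A = cyl S.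
Proof.
case=> N [C ->]; have [D ->] := Idx_fq N.
exists D, (finset (fun g => `[< C = [set a | D a = g] >])); apply/seteqP; split => x /=.
  by move=> <-; rewrite /cyl /= finset.in_set; apply/asboolP; exact: fq_projE.
by rewrite /cyl /= finset.in_set => /asboolP ->; exact: fq_projE.
Qed.

(** The point [trans gamma (cone adm)] is the image of [gamma] in the completion, so Haar invariance
    under points yields invariance under [F]. *)
Lemma setmul_trans gamma x N :
  setmul (sval (trans gamma (cone adm)) N) (sval x N) = sval (trans gamma x) N.
Proof.
have [D ->] := Idx_fq N.
rewrite [sval (trans _ _) _]coset_fq [RHS]/= fq_projE; apply/seteqP; split => c.
  move=> [a [b [/= Da Db ->]]]; exists (fgmul (fginv gamma) (fgmul a b)); last exact: fgmulKV.
  by rewrite /= !fq_hom fghomV; [rewrite Da mulKg|exact: fq_hom].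
by move=> [b Db <-]; exists gamma, b.
Qed.

Section Haar.
Variables (R : realType) (mu : probability T R).
Hypothesis mu_haar : is_haar mu.

Lemma haar_act_img gamma (A : set T) : measurable A -> mu (act_img gamma A) = mu A.
Proof.
move=> mA; rewrite -[RHS](mu_haar (trans gamma (cone adm)))//; congr (mu _).
apply/seteqP; split => y [x Ax yx]; exists x => // N; rewrite yx.
  by rewrite setmul_trans.
by rewrite -[RHS]setmul_trans.
Qed.

(** As [D] is surjective, [F] permutes the fibres of [fq_proj D] transitively. They have equal mass,
    and the total mass is 1. *)
Lemma mu_cyl D (S : {set fq_type D}) :
  mu (cyl S) = ((#|S|%:R / #|fq_type D|%:R)%R)%:E.
Proof.
pose m := fine (mu (cyl [set (1%g : fq_type D)]%SET)).
have mE (g : fq_type D) : mu (cyl [set g]%SET) = m%:E.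
  have [a <-] := fq_surj g.
  rewrite fineK; last by apply: fin_num_measure; exact: measurable_cyl.
  rewrite -[RHS](haar_act_img a (measurable_cyl _)) act_img_cyl; congr (mu (cyl _)).
  by apply/setP => h; rewrite !finset.inE -eq_mulVg1 eq_sym.
have cylE (S' : {set fq_type D}) : mu (cyl S') = (#|S'|%:R * m)%:E.
  have -> : cyl S' = \bigcup_(g in [set` S']) cyl [set g]%SET.
    apply/seteqP; split => x; rewrite /cyl /=.
      by move=> Sx; exists (fq_proj D x) => //=; rewrite finset.in_set1.
    by case=> g Sg /=; rewrite finset.in_set1 => /eqP ->.
  rewrite measure_fin_bigcup//; last by move=> g _; exact: measurable_cyl.
    rewrite -[LHS](bigfs _ (r := index_enum (fq_type D)) (P := mem S'));
      rewrite ?index_enum_uniq//; last first.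
      by move=> i _; rewrite mem_index_enum.
    rewrite (eq_bigr (fun=> m%:E)) => [|g _]; last exact: mE.
    by rewrite sumEFin (sumr_const (mem S') m) mulr_natl.
  apply/trivIsetP => g h _ _ gh; apply/seteqP; split => // x; rewrite /cyl /=.
  by rewrite !finset.in_set1 => -[/eqP -> /eqP] /eqP; rewrite (negbTE gh).
have := cylE finset.setT; rewrite (_ : cyl _ = setT); last first.
  by apply/seteqP; split => // x _; rewrite /cyl /= finset.in_setT.
rewrite probability_setT cardsT => -[] m1; rewrite cylE; congr EFin.
have G0 : (#|fq_type D|%:R != 0 :> R)%R.
  by rewrite pnatr_eq0 -lt0n; apply/card_gt0P; exists 1%g.
by rewrite -[m](mulKf G0) -m1 mulr1.
Qed.

End Haar.

Hypothesis Q_sub : forall (gT : finGroupType) (H : {group gT}), Q gT -> Q (subg_of H).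
Hypothesis Q_prod : forall gT1 gT2 : finGroupType, Q gT1 -> Q gT2 -> Q (gT1 * gT2)%type.
Hypothesis Q_ex : exists gT, Q gT.

Lemma fquot_corestr (gT : finGroupType) (phi : FG n -> gT) : fghom phi -> Q gT ->
  exists D (u : fq_type D -> gT), forall a, phi a = u (D a).
Proof.
move=> hphi q.
exists (FQuot (corestr_hom hphi) (@corestr_surj _ _ _ hphi) (Q_sub _ q)), val => a /=.
by rewrite corestrE.
Qed.

Lemma fquot_ex : exists D : fquot, True.
Proof.
have [gT q] := Q_ex; have h : fghom (fun _ : FG n => 1%g : gT) by move=> ? ?; rewrite mulg1.
by have [D _] := fquot_corestr h q; exists D.
Qed.

(** The common refinement is the image of [F] in the product group, hence the closure of [Q] under
    products and subgroups. *)
Lemma fquot_prod D D' : exists D'' (u : fq_type D'' -> fq_type D) (v : fq_type D'' -> fq_type D'),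
  (forall a, D a = u (D'' a)) /\ (forall a, D' a = v (D'' a)).
Proof.
pose phi a : (fq_type D * fq_type D')%type := (D a, D' a).
have hphi : fghom phi by move=> a b; rewrite /phi !fq_hom.
have [D'' [u Du]] := fquot_corestr hphi (Q_prod (fq_prop D) (fq_prop D')).
by exists D'', (fst \o u), (snd \o u); split => a /=; rewrite -Du.
Qed.

Definition is_cyl (A : set T) := exists D (S : {set fq_type D}), A = cyl S.

Lemma cyl_le D D' (u : fq_type D -> fq_type D') (S : {set fq_type D'}) :
  (forall a, D' a = u (D a)) -> cyl S = cyl (u @^-1: S).
Proof.
move=> DD'; rewrite /cyl; apply/seteqP; split => x /=; by rewrite (fq_proj_le _ DD') finset.inE.
Qed.

Lemma is_cylC A : is_cyl A -> is_cyl (~` A).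
Proof.
move=> [D [S ->]]; exists D, (finset.setC S); apply/seteqP; split => x;
by rewrite /cyl /= finset.in_setC => /negP.
Qed.

Lemma is_cylU A B : is_cyl A -> is_cyl B -> is_cyl (A `|` B).
Proof.
move=> [D [S ->]] [D' [S' ->]]; have [D'' [u [v [Du Dv]]]] := fquot_prod D D'.
rewrite (cyl_le _ Du) (cyl_le _ Dv); exists D'', (u @^-1: S :|: v @^-1: S').
apply/seteqP; split => x; rewrite /cyl /= finset.in_setU.
  by case=> ->; rewrite ?orbT.
by move=> /orP[]; [left|right].
Qed.

Lemma is_cyl_common k (A : 'I_k -> set T) : (forall i, is_cyl (A i)) ->
  exists D (S : 'I_k -> {set fq_type D}), forall i, A i = cyl (S i).
Proof.
elim: k A => [|k ih] A cA.
  by have [D _] := fquot_ex; exists D, (fun=> finset.set0) => -[].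
have [D [S AS]] := ih (A \o lift ord0) (fun i => cA _).
have [D' [S' AS']] := cA ord0.
have [D'' [u [v [Du Dv]]]] := fquot_prod D D'.
exists D'', (fun i => if unlift ord0 i is Some j then u @^-1: S j else v @^-1: S') => i.
case: unliftP => [j|] ->; last by rewrite AS' (cyl_le _ Dv).
by have /= -> := AS j; rewrite (cyl_le _ Du).
Qed.

End Completions.

(** * Weak containment *)

Section EquidistributionOfAlmostEquivariantMaps.
Variables (uT vT : finGroupType) (f : uT -> vT) (b : nat).
Local Open Scope group_scope.
Hypothesis f_almost : forall v, exists u, (defect f u v <= b)%N.

Let fiber g := #|[set t | f t == g]|.

(** Translation by a [u] matched with [h * g^-1] carries the fibre over [g] into the fibre over [h],
    except for at most [b] points. *)
Lemma fiber_le g h : (fiber g <= fiber h + b)%N.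
Proof.
have [u ub] := f_almost (h * g^-1).
apply: leq_trans (leq_add (leqnn _) ub).
have -> : fiber h = #|[set t | f (u * t) == h]|.
  rewrite -[RHS](card_imset _ (mulgI u)); apply: eq_card => t.
  by rewrite -[t](mulKVg u) mem_imset ?finset.in_set//; exact: mulgI.
rewrite /defect -cardsUI (leq_trans _ (leq_addr _ _))//; apply/subset_leq_card.
apply/fintype.subsetP => t; rewrite !finset.inE => /eqP fg.
by rewrite fg mulgKV; case: eqP.
Qed.

Lemma sum_fiber (W : {set vT}) : (\sum_(g in W) fiber g = #|[set t | f t \in W]|)%N.
Proof.
rewrite -[RHS]sum1_card (partition_big f (mem W)) /=; last by move=> t; rewrite finset.in_set.
apply: eq_bigr => g gW; rewrite /fiber -sum1_card; apply: eq_bigl => t.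
by rewrite !finset.in_set; case: eqP => [->|_]; rewrite ?gW ?andbF.
Qed.

Lemma fiber_equidistributed g :
  (#|vT| * fiber g <= #|uT| + #|vT| * b)%N && (#|uT| <= #|vT| * fiber g + #|vT| * b)%N.
Proof.
have -> : #|uT| = (\sum_(h : vT) fiber h)%N.
  rewrite (eq_bigl (mem [set: vT])) => [|h]; last by rewrite /= finset.in_setT.
  by rewrite sum_fiber; apply: eq_card => t; rewrite !finset.inE.
rewrite -!sum_nat_const -!big_split /=.
by apply/andP; split; apply: leq_sum => h _; exact: fiber_le.
Qed.

(** The preimage of [WS] mediates: its size [Z] differs from [X] by at most [b] by almost
    equivariance, and equidistribution compares [#|vT| * Z] with [W * #|uT|]. *)
Lemma almost_equivariant_count u v (S S' : {set vT}) : (defect f u v <= b)%N ->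
  let X := #|[set t | f (u^-1 * t) \in S] :&: [set t | f t \in S']| in
  let W := #|[set g | v^-1 * g \in S] :&: S'| in
  (#|vT| * X <= W * #|uT| + #|vT|.+1 * #|vT| * b)%N &&
  (W * #|uT| <= #|vT| * X + #|vT|.+1 * #|vT| * b)%N.
Proof.
move=> uv /=; set X := #|_ :&: _|; set WS := [set g | _] :&: S'; set W := #|WS|.
pose Z := #|[set t | f t \in WS]|.
have bad := leq_trans (defectV f u v) uv; rewrite /defect in bad.
have XZ : (X <= Z + b)%N.
  apply: leq_trans (leq_add (leqnn _) bad).
  rewrite -cardsUI (leq_trans _ (leq_addr _ _))//; apply/subset_leq_card.
  apply/fintype.subsetP => t; rewrite !finset.inE => /andP[ftS ->].
  by rewrite andbT; case: eqP => [<-|]; rewrite ?ftS ?orbT.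
have ZX : (Z <= X + b)%N.
  apply: leq_trans (leq_add (leqnn _) bad).
  rewrite -cardsUI (leq_trans _ (leq_addr _ _))//; apply/subset_leq_card.
  apply/fintype.subsetP => t; rewrite !finset.inE => /andP[ftS ->].
  by rewrite andbT; case: eqP => [->|]; rewrite ?ftS ?orbT.
have WT : (W <= #|vT|)%N by exact: max_card.
have ZW : (#|vT| * Z <= W * (#|uT| + #|vT| * b))%N.
  rewrite /Z -sum_fiber big_distrr /= -sum_nat_const.
  by apply: leq_sum => g _; have /andP[] := fiber_equidistributed g.
have WZ : (W * #|uT| <= #|vT| * Z + W * (#|vT| * b))%N.
  rewrite /Z -sum_fiber big_distrr /= -[(W * #|uT|)%N]sum_nat_const.
  rewrite -[(W * (_ * b))%N]sum_nat_const -big_split /=.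
  by apply: leq_sum => g _; have /andP[] := fiber_equidistributed g.
have Wb : (W * (#|vT| * b) <= #|vT| * (#|vT| * b))%N by rewrite leq_mul2r WT orbT.
have XZ' : (#|vT| * X <= #|vT| * (Z + b))%N by rewrite leq_mul2l XZ orbT.
have ZX' : (#|vT| * Z <= #|vT| * (X + b))%N by rewrite leq_mul2l ZX orbT.
move: ZW WZ Wb XZ' ZX'; rewrite !mulnDr mulSn mulnDl -!mulnA.
by move: (_ * _)%N (_ * _)%N (_ * (_ * _))%N (_ * _)%N (_ * (_ * _))%N (_ * _)%N; lia.
Qed.

(** Dividing the count by [#|uT| * #|vT|] leaves an error proportional to [b / #|uT|], which is at
    most [1 / K]. *)
Lemma almost_equivariant_frequency (R : realType) (K : nat) u v (S S' : {set vT}) :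
  (0 < K)%N -> (b * K <= #|uT|)%N -> (defect f u v <= b)%N ->
  (`| #|[set t | f (u^-1 * t)%g \in S] :&: [set t | f t \in S']|%:R / #|uT|%:R -
     #|[set g | (v^-1 * g)%g \in S] :&: S'|%:R / #|vT|%:R | <= #|vT|.+1%:R / K%:R :> R)%R.
Proof.
move=> K0 bK /(almost_equivariant_count S S') /=.
set X := #|_ :&: _|; set W := #|_ :&: S'| => /andP[XW WX].
have u0 : (0 < #|uT|)%N by apply/card_gt0P; exists 1.
have v0 : (0 < #|vT|)%N by apply/card_gt0P; exists 1.
move: u0 v0 XW WX bK; move: #|uT| #|vT| => x y x0 y0.
rewrite -!(ler_nat R) !natrM !natrD !natrM => XW WX bK.
have xR : (0 < x%:R :> R)%R by rewrite ltr0n.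
have yR : (0 < y%:R :> R)%R by rewrite ltr0n.
have KR : (0 < K%:R :> R)%R by rewrite ltr0n.
have bx : (y.+1%:R * b%:R / x%:R <= y.+1%:R / K%:R :> R)%R.
  rewrite ler_pdivrMr// mulrAC ler_pdivlMr// -mulrA ler_wpM2l//.
apply: le_trans bx.
rewrite (_ : X%:R / x%:R = (y%:R * X%:R) / (x%:R * y%:R))%R; last by field; rewrite !gt_eqF.
rewrite (_ : W%:R / y%:R = (W%:R * x%:R) / (x%:R * y%:R))%R; last by field; rewrite !gt_eqF.
rewrite (_ : y.+1%:R * b%:R / x%:R = (y.+1%:R * y%:R * b%:R) / (x%:R * y%:R))%R; last first.
  by field; rewrite !gt_eqF.
rewrite ler_distl -mulrBl -mulrDl !ler_pM2r ?invr_gt0 ?mulr_gt0//.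
by apply/andP; split; lra.
Qed.

End EquidistributionOfAlmostEquivariantMaps.

(** * Estimates with symmetric differences *)

Section SymmetricDifferences.
Context {d} {T : measurableType d} {R : realType} (P : probability T R).
Local Open Scope classical_set_scope.
Local Open Scope ereal_scope.

Lemma measurable_setY (A B : set T) : measurable A -> measurable B -> measurable (A `+` B).
Proof. by move=> mA mB; apply: measurableU; apply: measurableD. Qed.

Lemma measure_setY_le (A B C D E F : set T) :
  measurable A -> measurable B -> measurable C -> measurable D ->
  measurable E -> measurable F ->
  E `+` F `<=` (A `+` B) `|` (C `+` D) ->
  P (E `+` F) <= P (A `+` B) + P (C `+` D).
Proof.
move=> mA mB mC mD mE mF sub.
have mAB := measurable_setY mA mB; have mCD := measurable_setY mC mD.
apply: le_trans (measureU2 _ mAB mCD).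
by apply: le_measure => //; rewrite inE; [exact: measurable_setY|exact: measurableU].
Qed.

(** A point of one intersection outside the other lies in one of the two symmetric differences;
    [key] is applied in both directions. *)
Lemma measure_setI_dist (A B A' B' : set T) :
  measurable A -> measurable B -> measurable A' -> measurable B' ->
  (`|fine (P (A `&` B)) - fine (P (A' `&` B'))| <=
    fine (P (A `+` A')) + fine (P (B `+` B')))%R.
Proof.
move=> mA mB mA' mB'.
have key (C D C' D' : set T) : measurable C -> measurable D -> measurable C' -> measurable D' ->
    (fine (P (C `&` D)) <= fine (P (C' `&` D')) +
      (fine (P (C `+` C')) + fine (P (D `+` D'))))%R.
  move=> mC mD mC' mD'.
  have mCC := measurable_setY mC mC'; have mDD := measurable_setY mD mD'.
  have mI := measurableI _ _ mC' mD'; have mU := measurableU _ _ mCC mDD.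
  rewrite -lee_fin !EFinD !fineK ?fin_num_measure//; last exact: measurableI.
  apply: (@le_trans _ _ (P (C' `&` D') + P ((C `+` C') `|` (D `+` D')))); last first.
    by rewrite leeD2l// measureU2.
  apply: le_trans (measureU2 _ mI mU); apply: le_measure; rewrite ?inE.
  - exact: measurableI.
  - exact: measurableU.
  - move=> x [Cx Dx] /=.
    by have [] := pselect (C' x); have [] := pselect (D' x); tauto.
rewrite ler_distlC; have k1 := key _ _ _ _ mA mB mA' mB'.
have k2 := key _ _ _ _ mA' mB' mA mB; rewrite [A' `+` _]setYC [B' `+` _]setYC in k2.
by apply/andP; split; lra.
Qed.

End SymmetricDifferences.

(** * Density of cylinder sets in measure *)

Section CylinderApproximation.
Variables (n : nat) (Q : forall gT : finGroupType, Prop).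
Local Open Scope classical_set_scope.
Local Open Scope ereal_scope.
Local Notation adm := (@quotient_kernel n Q).
Local Notation T := (Mcompletion adm).
Variables (R : realType) (P : probability T R).
Hypothesis Q_sub : forall (gT : finGroupType) (H : {group gT}), Q gT -> Q (subg_of H).
Hypothesis Q_prod : forall gT1 gT2 : finGroupType, Q gT1 -> Q gT2 -> Q (gT1 * gT2)%type.
Hypothesis Q_ex : exists gT, Q gT.

Definition cyl_approximable (A : set T) := measurable A /\
  forall e : R, (0 < e)%R -> exists2 B, is_cyl B & P (A `+` B) < e%:E.

Lemma is_cyl_measurable (A : set T) : is_cyl A -> measurable A.
Proof. by move=> [D [S ->]]; exact: measurable_cyl. Qed.

Lemma is_cyl_approximable (A : set T) : is_cyl A -> cyl_approximable A.
Proof.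
move=> cA; split; first exact: is_cyl_measurable.
by move=> e e0; exists A => //; rewrite setYK measure0.
Qed.

Lemma cyl_approximableC (A : set T) : cyl_approximable A -> cyl_approximable (~` A).
Proof.
move=> [mA aA]; split; first exact: measurableC.
move=> e /aA[B cB AB]; exists (~` B); first exact: is_cylC.
rewrite (_ : ~` A `+` ~` B = A `+` B)//.
by rewrite /setY !setDE !setCK setUC ![_ `&` ~` _]setIC.
Qed.

Lemma cyl_approximable_add (A : set T) :
  measurable A ->
  (forall e : R, (0 < e)%R -> exists2 B, cyl_approximable B & P (A `+` B) < e%:E) ->
  cyl_approximable A.
Proof.
move=> mA aA; split => // e e0; have e20 : (0 < e / 2)%R by lra.
have [B [mB aB] AB] := aA _ e20; have [C cC BC] := aB _ e20.
exists C => //; have mC := is_cyl_measurable cC.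
apply: (@le_lt_trans _ _ (P (A `+` B) + P (B `+` C))).
  apply: measure_setY_le => // x /=.
  by have [] := pselect (B x); tauto.
by rewrite [e]splitr EFinD lteD.
Qed.

Lemma cyl_approximableU (A B : set T) :
  cyl_approximable A -> cyl_approximable B -> cyl_approximable (A `|` B).
Proof.
move=> [mA aA] [mB aB]; split; first exact: measurableU.
move=> e e0; have e20 : (0 < e / 2)%R by lra.
have [C cC AC] := aA _ e20; have [D cD BD] := aB _ e20.
have mC := is_cyl_measurable cC; have mD := is_cyl_measurable cD.
exists (C `|` D); first exact: is_cylU.
apply: (@le_lt_trans _ _ (P (A `+` C) + P (B `+` D))).
  apply: measure_setY_le => //; [exact: measurableU|exact: measurableU|].
  by move=> x /=; tauto.
by rewrite [e]splitr EFinD lteD.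
Qed.

Lemma cyl_approximable_bigcup (F : (set T)^nat) :
  (forall i, cyl_approximable (F i)) -> cyl_approximable (\bigcup_i F i).
Proof.
move=> aF.
pose G k := \big[setU/set0]_(i < k.+1) F i.
have aG k : cyl_approximable (G k).
  rewrite /G; elim: k => [|k ih]; first by rewrite big_ord1.
  by rewrite big_ord_recr /=; exact: cyl_approximableU.
have GE : \bigcup_i F i = \bigcup_k G k by rewrite bigcup_bigsetU_bigcup.
have mU : measurable (\bigcup_k G k) by apply: bigcupT_measurable => k; exact: (aG k).1.
have Gnd : nondecreasing_seq G.
  by move=> i j ij; apply/subsetPset; exact: subset_bigsetU.
rewrite GE; apply: cyl_approximable_add => // e e0.
have cv := nondecreasing_cvg_mu (mu := P) (fun k => (aG k).1) mU Gnd.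
(* Continuity from below: otherwise the limit of the measures of the finite unions would stay [e]
   below the measure of the whole union, which is finite. *)
have [k Pk] : exists k, P (\bigcup_k G k) - e%:E < P (G k).
  apply: contrapT => /forallNP noG.
  have : P (\bigcup_k G k) <= P (\bigcup_k G k) - e%:E.
    apply: (cvge_to_le cv); apply: nearW => k /=.
    by rewrite leNgt; apply/negP; exact: noG.
  rewrite -[P _]fineK ?fin_num_measure// -EFinB lee_fin; lra.
exists (G k) => //.
have -> : \bigcup_k G k `+` G k = \bigcup_k G k `\` G k.
  rewrite /setY (_ : G k `\` _ = set0) ?setU0// -subset0 => x [Gx]; apply.
  by exists k.
have mGk := (aG k).1.
rewrite measureD//; last by rewrite ltey_eq fin_num_measure.
rewrite (setIidr (bigcup_sup _))//.
rewrite lteBlDr ?fin_num_measure// addeC -lteBlDr//.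
Qed.

(** The approximable sets form a sigma-algebra containing the generating cylinders. *)
Lemma measurable_cyl_approximable (A : set T) : measurable A -> cyl_approximable A.
Proof.
apply: (smallest_sub (X := [set A | cyl_approximable A])).
  split => /=.
  - have := @cyl_approximable_bigcup (fun=> set0); rewrite bigcup0//; apply.
    move=> _; apply: is_cyl_approximable; have [D _] := fquot_ex n Q_sub Q_ex.
    by exists D, finset.set0; apply/seteqP; split => // x; rewrite /cyl /= finset.in_set0.
  - by move=> B aB; rewrite setTD; exact: cyl_approximableC.
  - by move=> F; exact: cyl_approximable_bigcup.
by move=> B /cylinders_cyl cB; exact: is_cyl_approximable.
Qed.
End CylinderApproximation.

(** * Weak containment from almost equivariant maps of finite quotients *)

Section WeakContainment.
Variables (n : nat) (Q1 Q2 : forall gT : finGroupType, Prop) (R : realType).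
Variables (mu : probability (Mcompletion (@quotient_kernel n Q1)) R)
  (nu : probability (Mcompletion (@quotient_kernel n Q2)) R).
Hypotheses (mu_haar : is_haar mu) (nu_haar : is_haar nu).
Hypothesis Q_sub : forall (gT : finGroupType) (H : {group gT}), Q2 gT -> Q2 (subg_of H).
Hypothesis Q_prod : forall gT1 gT2 : finGroupType, Q2 gT1 -> Q2 gT2 -> Q2 (gT1 * gT2)%type.
Hypothesis Q_ex : exists gT, Q2 gT.
Local Open Scope classical_set_scope.
Local Open Scope ring_scope.

Lemma weakly_contains_of_almost_equivariant :
  (forall (D : fquot n Q2) (L : seq (FG n)) (K : nat),
    exists (D' : fquot n Q1) (f : fq_type D' -> fq_type D),
      forall a, a \in L -> (defect f (D' a) (D a) * K <= #|fq_type D'|)%N) ->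
  weakly_contains (@act_img n (quotient_kernel Q1)) mu (@act_img n (quotient_kernel Q2)) nu.
Proof.
(* Replacing the sets by cylinders costs [eps / 4] for each of the two indices; the other [eps / 2]
   is left for comparing frequencies in finite groups. *)
move=> approx k A mA E eps eps0; have e40 : 0 < eps / 4 by lra.
have aA i := (measurable_cyl_approximable nu Q_sub Q_prod Q_ex (mA i)).2 _ e40.
have /choice[A' cA'] : forall i, exists B, is_cyl B /\ (nu (A i `+` B) < (eps / 4)%:E)%E.
  by move=> i; have [B ? ?] := aA i; exists B.
have [D [S A'S]] := is_cyl_common Q_sub Q_prod Q_ex (fun i => (cA' i).1).
pose c : R := (#|fq_type D|.+1)%:R.
pose K := (Num.bound (c / (eps / 2))).+1.
have Kc : c / K%:R < eps / 2.
  rewrite ltr_pdivrMr// mulrC -ltr_pdivrMr; last by lra.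
  by rewrite (lt_trans (archi_boundP _))// ?ltr_nat// divr_ge0//; lra.
pose rep g := sval (cid (@fq_surj _ _ D g)).
have repE g : D (rep g) = g by rewrite /rep; case: cid.
(* Besides [E], the list contains a lift of every element of the quotient, as equidistribution of
   [f] requires a partner [u] for each [v]. *)
have [D' [f fD]] := approx D (E ++ [seq rep g | g <- enum (fq_type D)]) K.
pose b := (#|fq_type D'| %/ K)%N.
have fb a : a \in E ++ [seq rep g | g <- enum (fq_type D)] -> (defect f (D' a) (D a) <= b)%N.
  by move=> /fD; rewrite leq_divRL.
have fv v : exists u, (defect f u v <= b)%N.
  exists (D' (rep v)); rewrite -{2}(repE v); apply: fb.
  by rewrite mem_cat map_f ?orbT// mem_enum.
(* The witnesses are the cylinders over the pullbacks along [f] of the finite sets approximating the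
   [A i]. *)
pose B i := cyl (f @^-1: S i).
exists B; split=> [i|i j gamma gE]; first exact: measurable_cyl.
have cylI D0 (U V : {set fq_type D0}) : cyl U `&` cyl V = cyl (U :&: V)%SET.
  by apply/seteqP; split => x; rewrite /cyl /= finset.in_setI => /andP.
have -> : fine (mu (act_img gamma (B i) `&` B j)) =
    #|[set t | f ((D' gamma)^-1 * t)%g \in S i]%SET :&: [set t | f t \in S j]%SET|%:R
      / #|fq_type D'|%:R.
  rewrite /B act_img_cyl cylI mu_cyl//=; congr (_%:R / _); apply: eq_card => t.
  by rewrite !finset.inE.
have nuE : fine (nu (act_img gamma (A' i) `&` A' j)) =
    #|[set g | ((D gamma)^-1 * g)%g \in S i]%SET :&: S j|%:R / #|fq_type D|%:R.
  by rewrite !A'S act_img_cyl cylI mu_cyl.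
have bK : (b * K <= #|fq_type D'|)%N by exact: leq_divM.
have gb : (defect f (D' gamma) (D gamma) <= b)%N by apply: fb; rewrite mem_cat gE.
have := almost_equivariant_frequency fv R (S i) (S j) (ltn0Sn _) bK gb.
rewrite -nuE -/c => muA'.
have mA' l : measurable (A' l) by rewrite A'S; exact: measurable_cyl.
have small l : fine (nu (A l `+` A' l)) < eps / 4.
  by rewrite -lte_fin fineK ?fin_num_measure//; [exact: (cA' l).2|exact: measurable_setY].
have small_img : fine (nu (act_img gamma (A i) `+` act_img gamma (A' i))) < eps / 4.
  have -> : act_img gamma (A i) `+` act_img gamma (A' i) = act_img gamma (A i `+` A' i).
    by rewrite (act_imgE gamma (A i)) (act_imgE gamma (A' i)) act_imgE.
  by rewrite (haar_act_img nu_haar gamma (measurable_setY (mA i) (mA' i))).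
have dist := measure_setI_dist nu (measurable_act_img gamma (mA i)) (mA j)
  (measurable_act_img gamma (mA' i)) (mA' j).
have triangle (x y z s t : R) : `|x - y| <= c / K%:R -> `|z - y| <= s + t ->
    s < eps / 4 -> t < eps / 4 -> `|x - z| < eps.
  rewrite !ler_norml !ltr_norml => /andP[xy1 xy2] /andP[zy1 zy2] s4 t4.
  by apply/andP; split; lra.
exact: triangle muA' dist small_img (small j).
Qed.

End WeakContainment.

(** * Closure properties of finite p-groups and solvable groups *)

Lemma pgroup_subg p (gT : finGroupType) (H : {group gT}) :
  pgroup p [set: gT] -> pgroup p [set: subg_of H].
Proof.
move=> pG; rewrite /pgroup -(card_isog (isog_subg H)).
exact: pgroupS (finset.subsetT _) pG.
Qed.

Lemma pgroup_prod p (gT1 gT2 : finGroupType) :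
  pgroup p [set: gT1] -> pgroup p [set: gT2] -> pgroup p [set: gT1 * gT2].
Proof. by rewrite /pgroup !cardsT card_prod pnatM => -> ->. Qed.

Lemma solvable_subg (gT : finGroupType) (H : {group gT}) :
  solvable [set: gT] -> solvable [set: subg_of H].
Proof.
move=> solG; rewrite -(isog_sol (isog_subg H)).
exact: solvableS (finset.subsetT _) solG.
Qed.

(** The second factor is normal and solvable, and the quotient by it is a quotient of the first
    factor. *)
Lemma solvable_prod (gT1 gT2 : finGroupType) :
  solvable [set: gT1] -> solvable [set: gT2] -> solvable [set: gT1 * gT2].
Proof.
move=> /(morphim_sol (pairg1_morphism gT1 gT2)) + /(morphim_sol (pair1g_morphism gT1 gT2)).
rewrite /= morphim_pairg1 morphim_pair1g => sol1 sol2.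
have dX := setX_dprod [set: gT1]%G [set: gT2]%G.
have XT : finset.setX [set: gT1] [set: gT2] = [set: gT1 * gT2].
  by apply/setP => -[x y]; rewrite finset.in_setX !finset.in_setT.
have [_ N2] := dprod_normal2 dX; rewrite -XT (series_sol N2) sol2 /=.
by have [_ <- _ _] := dprodP dX; rewrite quotientMidr quotient_sol.
Qed.

Theorem theorem10 (R : realType) (p n : nat) (hp : prime p)
  (mu : probability (Mcompletion (@pindex n p)) R)
  (nu : probability (Mcompletion (@solvindex n)) R) :
  is_haar mu -> is_haar nu ->
  weakly_equivalent (@act_img n (@pindex n p)) mu (@act_img n (@solvindex n)) nu.
Proof.
move=> mu_haar nu_haar.
pose Qp (gT : finGroupType) : Prop := pgroup p [set: gT].
pose Qs (gT : finGroupType) : Prop := solvable [set: gT].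
split.
- apply: (@weakly_contains_of_almost_equivariant n Qp Qs R mu nu mu_haar nu_haar).
  + exact: solvable_subg.
  + exact: solvable_prod.
  + by exists 'I_1; apply: abelian_sol; apply/centsP => x _ y _; rewrite !ord1.
  move=> D L K.
  have [pT [psi [f [hpsi spsi pp fL]]]] := p_group_approximation hp (@fq_hom _ _ D) (fq_prop D) L K.
  by exists (FQuot (Q := Qp) hpsi spsi pp), f.
- apply: (@weakly_contains_of_almost_equivariant n Qs Qp R nu mu nu_haar mu_haar).
  + exact: pgroup_subg.
  + exact: pgroup_prod.
  + by exists 'I_1; rewrite /Qp /pgroup cardsT card_ord.
  move=> D L K.
  (* A finite p-quotient is itself a solvable quotient, so the identity map serves, with defect
     zero. *)
  have solD : Qs (fq_type D) by exact: pgroup_sol (fq_prop D).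
  exists (FQuot (Q := Qs) (@fq_hom _ _ D) (@fq_surj _ _ D) solD), id => a _ /=.
  by rewrite /defect eq_card0// => t; rewrite finset.in_set eqxx.
Qed.
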